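(* Let $P$ and $Q$ be stationary ergodic processes on the same nonempty finite alphabet $\mathcal X$. For all integers $L,R\ge1$, $$C_{L,R}(P)=C_{L,R}(Q)\quad\Longleftrightarrow\quad P_{L+R}=Q_{L+R}.$$
   Context: Processes are bi-infinite, $(X_t)_{t\in\mathbb Z}$, with values in $\mathcal X$; $X_i^j=(X_i,\dots,X_j)$; $\mathcal X^n$ is the set of words of length $n$; $\lambda$ is the empty word. For a stationary process $P$ and $n\ge0$ the block law is $P_n(w)=P(X_1^n=w)$, $w\in\mathcal X^n$, with $P_0(\lambda)=1$. For $L\ge1$ let $\mathcal U_L(P)=\{u\in\bigcup_{\ell=1}^L\mathcal X^\ell: P(X_{-|u|+1}^0=u)>0\}$. For $u\in\mathcal U_L(P)$ and a word $v$ with $0\le|v|\le R$ put $P(v\mid u)=P(X_1^{|v|}=v\mid X_{-|u|+1}^0=u)$, $P(\lambda\mid u)=1$. The labeled conditional table is $C_{L,R}(P)=(P(v\mid u))_{u\in\mathcal U_L(P),\,|v|\le R}$. Equality $C_{L,R}(P)=C_{L,R}(Q)$ means $\mathcal U_L(P)=\mathcal U_L(Q)$ and $P(v\mid u)=Q(v\mid u)$ for every indexed pair $(u,v)$. *)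

(* Defs.v *)
From mathcomp Require Export all_boot all_order all_algebra.
From mathcomp Require Export classical_sets reals ereal measure.

Set Implicit Arguments.
Unset Strict Implicit.
Unset Printing Implicit Defensive.

Import Order.TTheory GRing.Theory Num.Theory.

Local Open Scope classical_set_scope.
Local Open Scope ring_scope.

(* The underlying probability space is arbitrary; stationarity, ergodicity and
   the block probabilities only depend on the law induced on [int -> X]. *)
Record process (K : realType) (X : finType) := Process {
  disp : measure_display;
  space : measurableType disp;
  prob : probability space K;
  coord : int -> space -> X;
  measurable_coord : forall t a, measurable (coord t @^-1` [set a])
}.

Section Process.
Variables (K : realType) (X : finType).
Implicit Types P Q : process K X.

Definition trajectory P (om : space P) : int -> X := fun t => coord t om.

(* Product sigma-algebra of the two-sided sequence space, X being discrete. *)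
Definition path_measurable : set (set (int -> X)) :=
  <<s [set A | exists t a, A = [set x : int -> X | x t = a]] >>.

Definition shift (x : int -> X) : int -> X := fun t => x (t + 1).

Definition pr P (A : set (space P)) : K := fine (prob P A).

Definition law P (A : set (int -> X)) : K := pr (@trajectory P @^-1` A).

Definition stationary P : Prop :=
  forall A, path_measurable A -> law P (shift @^-1` A) = law P A.

Definition ergodic P : Prop :=
  forall A, path_measurable A -> shift @^-1` A = A ->
    law P A = 0 \/ law P A = 1.

(* [block i n om] is the word X_i ... X_(i+n-1). *)
Definition block P (i : int) (n : nat) (om : space P) : seq X :=
  mkseq (fun k => coord (i + k%:Z) om) n.

Definition block_law P (n : nat) (w : n.-tuple X) : K :=
  pr [set om : space P | block 1 n om = w].

Definition past P (u : seq X) : set (space P) :=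
  [set om | block (1 - (size u)%:Z) (size u) om = u].
Arguments past : clear implicits.

Definition future P (v : seq X) : set (space P) :=
  [set om | block 1 (size v) om = v].
Arguments future : clear implicits.

Definition contexts (L : nat) P : set (seq X) :=
  [set u | (1 <= size u <= L)%N /\ 0 < pr (past P u)].

(* For [u] of positive probability, [cond_pr P [::] u = 1], since
   [future P [::]] is the whole space. *)
Definition cond_pr P (v u : seq X) : K :=
  pr (past P u `&` future P v) / pr (past P u).

Definition same_cond_table (L R : nat) P Q : Prop :=
  contexts L P = contexts L Q /\
  forall u v : seq X, contexts L P u -> (size v <= R)%N ->
    cond_pr P v u = cond_pr Q v u.

End Process.

Arguments past {K X} P u.
Arguments future {K X} P v.
Arguments block_law {K X} P n w.

(* Main.v *)
(** Since P_(k+l)(uv) = P_k(u) P(v | u), the table determines P_(L+R) from P_1,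
    adding one letter at a time up to length L and then R letters at once. As
    for P_1 and Q_1, both are stationary for the transition matrix P(b | a) and
    have the same support. The letters where P_1 - Q_1 > 0 are closed under
    this matrix, so by ergodicity of P their set or its complement is P_1-null;
    either way P_1 - Q_1 has constant sign and total mass 0, so it vanishes.
    Conversely, every entry of the table is a quotient of marginals of
    P_(L+R). *)

From mathcomp Require Import boolp cardinality fsbigop zify.
Require Import Defs.

Section Proof.
Set Implicit Arguments.
Unset Strict Implicit.
Unset Printing Implicit Defensive.
Import Order.TTheory GRing.Theory Num.Theory.
Local Open Scope classical_set_scope.
Local Open Scope ring_scope.

(** * Measurable sets of paths and cylinders *)

Section PathMeasurable.
Variable X : finType.
Implicit Types A B : set (int -> X).

Lemma path_measurableC A : path_measurable A -> path_measurable (~` A).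
Proof. by rewrite -setTD; exact: sigma_algebraCD. Qed.

Lemma path_measurable0 : path_measurable (set0 : set (int -> X)).
Proof. exact: sigma_algebra0. Qed.

Lemma path_measurableT : path_measurable ([set: int -> X]).
Proof. by rewrite -setC0; apply: path_measurableC; exact: path_measurable0. Qed.

Lemma path_measurable_bigcup (I : countType) (F : I -> set (int -> X)) :
  (forall i, path_measurable (F i)) -> path_measurable (\bigcup_i F i).
Proof.
move=> mF.
have -> : \bigcup_i F i = \bigcup_n oapp F set0 (unpickle n).
  apply/seteqP; split=> [x [i _ Fx]|x [n _]].
    by exists (pickle i); rewrite ?pickleK.
  by case: unpickle => //= i Fx; exists i.
apply: sigma_algebra_bigcup => n; case: unpickle => [i|]; first exact: mF.
exact: path_measurable0.
Qed.

Lemma path_measurable_bigcap (I : countType) (F : I -> set (int -> X)) :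
  (forall i, path_measurable (F i)) -> path_measurable (\bigcap_i F i).
Proof.
move=> mF; rewrite -[X in path_measurable X]setCK setC_bigcap.
apply: path_measurableC; apply: path_measurable_bigcup => i.
exact: path_measurableC.
Qed.

Lemma path_measurableI A B :
  path_measurable A -> path_measurable B -> path_measurable (A `&` B).
Proof.
move=> mA mB; have -> : A `&` B = \bigcap_(b : bool) (if b then A else B).
  apply/seteqP; split=> [x [Ax Bx] []|x ABx] //.
  by split; [exact: (ABx true)|exact: (ABx false)].
by apply: path_measurable_bigcap; case.
Qed.

(** Phrased with [mkseq], as [block] is, so that [past] and [future] are preimages of cylinders by
    conversion. *)
Definition cylinder (i : int) (w : seq X) : set (int -> X) :=
  [set x | mkseq (fun k => x (i + k%:Z)) (size w) = w].

Lemma cylinder0 i : cylinder i [::] = setT.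
Proof. by apply/seteqP; split. Qed.

Lemma cylinder1 i a : cylinder i [:: a] = [set x | x i = a].
Proof.
by apply/seteqP; rewrite /cylinder /mkseq /= addr0; split=> x /= => [[]|->].
Qed.

Lemma cylinder_cat i (u v : seq X) :
  cylinder i (u ++ v) = cylinder i u `&` cylinder (i + (size u)%:Z) v.
Proof.
have E (x : int -> X) : mkseq (fun k => x (i + k%:Z)) (size (u ++ v)) =
    mkseq (fun k => x (i + k%:Z)) (size u) ++
    mkseq (fun k => x (i + (size u)%:Z + k%:Z)) (size v).
  rewrite /mkseq size_cat iotaD map_cat add0n; congr (_ ++ _).
  rewrite -[X in iota X]addn0 iotaDl -map_comp; apply: eq_map => k /=.
  by rewrite PoszD addrA.
apply/seteqP; split=> x; rewrite /cylinder /= E.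
  move/eqP; rewrite eqseq_cat ?size_mkseq//.
  by move=> /andP[/eqP ? /eqP ?]; split.
by move=> [-> ->].
Qed.

Lemma cylinder2 i a b : cylinder i [:: a; b] = [set x | x i = a /\ x (i + 1) = b].
Proof. by rewrite (cylinder_cat i [:: a] [:: b]) !cylinder1. Qed.

Lemma path_measurable_cylinder i w : path_measurable (cylinder i w).
Proof.
elim: w i => [|a w IHw] i; first by rewrite cylinder0; exact: path_measurableT.
rewrite (cylinder_cat i [:: a]) cylinder1; apply: path_measurableI => //.
by apply: sub_sigma_algebra; exists i, a.
Qed.

Lemma shift_cylinder i w : @shift X @^-1` cylinder i w = cylinder (i + 1) w.
Proof.
have E (x : int -> X) : mkseq (fun k => shift x (i + k%:Z)) (size w) =
    mkseq (fun k => x (i + 1 + k%:Z)) (size w).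
  by apply: eq_mkseq => k; rewrite /shift addrAC.
by apply/seteqP; split=> x; rewrite /cylinder /= E.
Qed.

End PathMeasurable.

(** * The law as a probability on path space *)

Section Law.
Variables (K : realType) (X : finType) (P : process K X).
Implicit Types A B : set (int -> X).

Lemma measurable_trajectory A :
  path_measurable A -> measurable (@trajectory K X P @^-1` A).
Proof.
apply: (@smallest_sub _ (sigma_algebra setT) _
  [set A | measurable (@trajectory K X P @^-1` A)]); last first.
  by move=> _ [t [a ->]]; exact: (@measurable_coord K X P t a).
split=> [|B mB|F mF] /=.
- by rewrite preimage_set0.
- by rewrite setTD preimage_setC; exact: measurableC.
- by rewrite preimage_bigcup; exact: bigcupT_measurable.
Qed.

Lemma law_fin_num A : path_measurable A ->
  prob P (@trajectory K X P @^-1` A) \is a fin_num.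
Proof. by move=> mA; apply/fin_num_measure/measurable_trajectory. Qed.

Lemma law_eq0 A : path_measurable A ->
  (prob P).-negligible (@trajectory K X P @^-1` A) <-> law P A = 0.
Proof.
move=> mA; rewrite negligibleP; last exact: measurable_trajectory.
rewrite /law /pr; split=> [->//|/eqP].
by rewrite fine_eq0 ?law_fin_num// => /eqP.
Qed.

Lemma law_ge0 A : 0 <= law P A.
Proof. exact/fine_ge0/measure_ge0. Qed.

Lemma lawT : law P setT = 1.
Proof. by rewrite /law /pr preimage_setT probability_setT. Qed.

Lemma lawC A : path_measurable A -> law P (~` A) = 1 - law P A.
Proof.
move=> mA; rewrite /law /pr preimage_setC.
rewrite probability_setC; last exact: measurable_trajectory.
by rewrite fineB // law_fin_num.
Qed.

Lemma law_sum A t : path_measurable A ->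
  law P A = \sum_(a : X) law P (A `&` cylinder t [:: a]).
Proof.
move=> mA; pose F a := @trajectory K X P @^-1` (A `&` cylinder t [:: a]).
have mF a : path_measurable (A `&` cylinder t [:: a]).
  by apply: path_measurableI => //; exact: path_measurable_cylinder.
rewrite /law /pr sum_fine; last by move=> a _; exact: law_fin_num.
have -> : @trajectory K X P @^-1` A = \bigcup_(a in [set` index_enum X]) F a.
  apply/seteqP; split=> [om Aom|om [a _ []]//].
  by exists (coord t om); rewrite /= ?mem_index_enum // /F cylinder1.
rewrite measure_fin_bigcup.
- by rewrite -fsbig_seq // index_enum_uniq.
- exact: finite_seq.
- apply/trivIsetP => a b _ _ neab; apply/seteqP; split=> // om [].
  rewrite /F !cylinder1 /= => -[_ ->] [_ ab].
  by rewrite ab eqxx in neab.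
- by move=> a _; apply: measurable_trajectory; exact: mF.
Qed.

Lemma law_bigcup0 (I : countType) (F : I -> set (int -> X)) :
  (forall i, path_measurable (F i)) -> (forall i, law P (F i) = 0) ->
  law P (\bigcup_i F i) = 0.
Proof.
move=> mF F0; apply/law_eq0; first exact: path_measurable_bigcup.
pose G n := oapp (fun i => @trajectory K X P @^-1` F i) set0 (unpickle n).
apply: (@negligibleS _ _ _ _ (\bigcup_n G n)).
  by move=> om [i _ Fi]; exists (pickle i); rewrite /G ?pickleK.
apply: negligible_bigcup => n; rewrite /G.
case: unpickle => [i|] /=; last exact: negligible_set0.
exact/law_eq0.
Qed.

Lemma law_sub0 A B : path_measurable A -> path_measurable B ->
  A `<=` B -> law P B = 0 -> law P A = 0.
Proof.
move=> mA mB AB /(law_eq0 mB) B0; apply/law_eq0 => //.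
by apply: negligibleS B0 => om /AB.
Qed.

End Law.

(** * Word probabilities under stationarity and ergodicity *)

Section Words.
Variables (K : realType) (X : finType) (P : process K X).
Hypothesis statP : stationary P.

Definition word_pr (w : seq X) : K := law P (cylinder 1 w).

Lemma law_cylinder i w : law P (cylinder i w) = word_pr w.
Proof.
have S j : law P (cylinder (j + 1) w) = law P (cylinder j w).
  by rewrite -shift_cylinder statP//; exact: path_measurable_cylinder.
rewrite /word_pr -[1%R]add0r S; elim/int_rec: i => // n IHn.
  by rewrite -[n.+1]addn1 PoszD S.
by rewrite -IHn -S -addn1 PoszD opprD addrNK.
Qed.

Lemma word_pr_ge0 w : 0 <= word_pr w.
Proof. exact: law_ge0. Qed.

Lemma word_pr_nil : word_pr [::] = 1.
Proof. by rewrite /word_pr cylinder0 lawT. Qed.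

Lemma word_pr_rcons w : word_pr w = \sum_a word_pr (rcons w a).
Proof.
rewrite /word_pr (law_sum _ (1 + (size w)%:Z)); last first.
  exact: path_measurable_cylinder.
by apply: eq_bigr => a _; rewrite -cats1 cylinder_cat.
Qed.

(** Keep [w] at time 1 and split on the letter at time 0; stationarity moves the longer word back to
    time 1. *)
Lemma word_pr_cons w : word_pr w = \sum_a word_pr (a :: w).
Proof.
rewrite -(law_cylinder 1) (law_sum _ 0); last exact: path_measurable_cylinder.
apply: eq_bigr => a _; rewrite -(law_cylinder 0).
by rewrite (cylinder_cat 0 [:: a] w) add0r setIC.
Qed.

Lemma word_pr_cat0 u v : word_pr u = 0 -> word_pr (u ++ v) = 0.
Proof.
move=> u0; apply: (law_sub0 _ _ _ u0); try exact: path_measurable_cylinder.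
by rewrite cylinder_cat => x [].
Qed.

Lemma pr_past u : pr (past P u) = word_pr u.
Proof. by rewrite -(law_cylinder (1 - (size u)%:Z)). Qed.

Lemma pr_past_future u v : pr (past P u `&` future P v) = word_pr (u ++ v).
Proof.
by rewrite -(law_cylinder (1 - (size u)%:Z)) cylinder_cat subrK.
Qed.

Lemma contextsE L u :
  contexts L P u <-> (1 <= size u <= L)%N /\ word_pr u != 0.
Proof. by rewrite /contexts /= pr_past lt0r word_pr_ge0 andbT. Qed.

Lemma cond_prE v u : cond_pr P v u = word_pr (u ++ v) / word_pr u.
Proof. by rewrite /cond_pr pr_past pr_past_future. Qed.

Lemma block_lawE n (w : n.-tuple X) : block_law P n w = word_pr w.
Proof. by rewrite /word_pr /law /cylinder size_tuple. Qed.

(* By stationarity the flow from [S] to its complement balances the opposite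
   flow. *)
Lemma closed_backward (S : {pred X}) :
  (forall a b, a \in S -> b \notin S -> word_pr [:: a; b] = 0) ->
  forall a b, a \notin S -> b \in S -> word_pr [:: a; b] = 0.
Proof.
move=> S0.
have E1 : \sum_(a in S) word_pr [:: a] =
    \sum_(a in S) \sum_(b in S) word_pr [:: a; b].
  apply: eq_bigr => a aS; rewrite word_pr_rcons /= [LHS](bigID (mem S)) /=.
  by rewrite [X in _ + X]big1 ?addr0// => b bS; exact: S0.
(* [E1] splits the mass of [S] by the following letter. Splitting it by the preceding letter adds
   the flow into [S], which comparison with [E1] forces to be 0. *)
have E2 : \sum_(b in S) word_pr [:: b] =
    \sum_(a in S) \sum_(b in S) word_pr [:: a; b] +
    \sum_(b in S) \sum_(a | a \notin S) word_pr [:: a; b].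
  rewrite exchange_big -big_split; apply: eq_bigr => b _ /=.
  by rewrite word_pr_cons (bigID (mem S)).
have E : \sum_(b in S) \sum_(a | a \notin S) word_pr [:: a; b] = 0.
  by apply: (addrI (\sum_(a in S) word_pr [:: a])); rewrite {1}E1 -E2 addr0.
move=> a b aS bS.
have Eb : \sum_(a | a \notin S) word_pr [:: a; b] = 0.
  apply: (psumr_eq0P _ E) => // c _.
  by apply: sumr_ge0 => ? _; exact: word_pr_ge0.
by apply: (psumr_eq0P _ Eb) => // c _; exact: word_pr_ge0.
Qed.

Hypothesis ergP : ergodic P.

(* The set of paths staying in [S] forever is strictly shift-invariant, and
   differs by a null set from [X_1 \in S]. *)
Lemma closed_trivial (S : {pred X}) :
  (forall a b, a \in S -> b \notin S -> word_pr [:: a; b] = 0) ->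
  (forall a, a \in S -> word_pr [:: a] = 0) \/
  (forall a, a \notin S -> word_pr [:: a] = 0).
Proof.
move=> S0; have S0' := closed_backward S0.
pose A := [set x : int -> X | forall t, x t \in S].
have mA : path_measurable A.
  (* A countable intersection: each letter outside [S] is excluded at each time. *)
  have -> : A = \bigcap_(p : int * X)
      (if p.2 \in S then setT else ~` cylinder p.1 [:: p.2]).
    apply/seteqP; split=> [x Ax [t a] _ /=|x Ax t].
      case: ifPn => // aS; rewrite cylinder1 /= => xa.
      by rewrite -xa Ax in aS.
    apply/negPn/negP => xS; have := Ax (t, x t) I.
    by rewrite /= (negbTE xS) cylinder1; apply.
  apply: path_measurable_bigcap => -[t a] /=; case: ifP => _.
    exact: path_measurableT.
  apply: path_measurableC; exact: path_measurable_cylinder.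
have sA : @shift X @^-1` A = A.
  apply/seteqP; split=> x Ax t; last exact: Ax.
  by have := Ax (t - 1); rewrite /shift subrK.
have [A0|A1] := ergP mA sA; [left|right] => a aS.
  (* Crossings of the border of [S], indexed by the time and the two letters. Those leaving [S] are
     null by [S0], those entering it by [S0']. *)
  pose N (p : int * X * X) := if (p.1.2 \in S) != (p.2 \in S)
    then cylinder p.1.1 [:: p.1.2; p.2] else set0.
  have mN p : path_measurable (N p).
    rewrite /N; case: ifP => _; first exact: path_measurable_cylinder.
    exact: path_measurable0.
  have N0 : law P (\bigcup_p N p) = 0.
    apply: law_bigcup0 => // -[[t c] d]; rewrite /N /=.
    case: ifPn => [cd|_]; last by rewrite /law /pr preimage_set0 measure0.
    rewrite law_cylinder; move: cd.
    have [cS|cS] := boolP (c \in S); have [dS|dS] := boolP (d \in S) => // _.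
      exact: S0.
    exact: S0'.
  (* A family of two null sets whose union covers the event that the letter at time 1 is [a]. *)
  pose B (b : bool) := if b then A else \bigcup_p N p.
  have mB b : path_measurable (B b).
    by case: b => //; exact: path_measurable_bigcup.
  apply: (@law_sub0 _ _ _ _ (\bigcup_b B b)).
  - exact: path_measurable_cylinder.
  - exact: path_measurable_bigcup.
  - rewrite cylinder1 => x /= xa.
    have [xN|xN] := pselect ((\bigcup_p N p) x); first by exists false.
    exists true => // t.
    (* A path without crossings stays on one side of [S], and it is in [S] at time 1. *)
    have step s : (x s \in S) = (x (s + 1) \in S).
      apply/eqP/negPn/negP => sS; apply: xN.
      by exists (s, x s, x (s + 1)) => //; rewrite /N /= sS cylinder2.
    have x0 : x 0 \in S by rewrite step add0r xa.
    elim/int_rec: t => [//|n|n].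
      by rewrite step -PoszD addn1.
    by rewrite [in X in _ -> X]step -[n.+1]addn1 PoszD opprD addrNK.
  - by apply: law_bigcup0 => // -[].
(* [A] now has law 1, and a path through [a] outside [S] lies in its null complement. *)
apply: (@law_sub0 _ _ _ _ (~` A)).
- exact: path_measurable_cylinder.
- exact: path_measurableC.
- by rewrite cylinder1 => x /= xa Ax; rewrite -xa Ax in aS.
- by rewrite lawC// A1 subrr.
Qed.

End Words.

(** * Signed invariant vectors of a substochastic matrix *)

(** Sum the invariance of [d] over its positive set: entries with [d a <= 0] contribute nothing
    positive, so the positive mass must be supplied from within. As rows have sum at most 1, none of
    it can leak out. *)
Lemma sub_stationary_positive_closed (K : realFieldType) (X : finType)
    (M : X -> X -> K) (d : X -> K) :
  (forall a b, 0 <= M a b) -> (forall a, \sum_b M a b <= 1) ->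
  (forall b, d b = \sum_a d a * M a b) ->
  forall a b, 0 < d a -> d b <= 0 -> M a b = 0.
Proof.
move=> M0 M1 dM.
have le : \sum_(a | 0 < d a) d a <=
    \sum_(a | 0 < d a) d a * \sum_(b | 0 < d b) M a b.
  under eq_bigr do rewrite dM.
  rewrite exchange_big /= (bigID (fun a => 0 < d a)) /=.
  under eq_bigr do rewrite -mulr_sumr.
  rewrite gerDl; apply: sumr_le0 => a; rewrite -leNgt => da.
  by rewrite -mulr_sumr mulr_le0_ge0// sumr_ge0.
(* The leak out of the positive set: it is nonnegative, and by [le] and the row bound at most 0. *)
have E : \sum_(a | 0 < d a) d a * \sum_(b | ~~ (0 < d b)) M a b = 0.
  apply/eqP; rewrite eq_le sumr_ge0 ?andbT; last first.
    by move=> a /ltW da; rewrite mulr_ge0// sumr_ge0.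
  rewrite -subr_ge0 sub0r -sumrN.
  apply: le_trans (_ : \sum_(a | 0 < d a) d a * \sum_(b | 0 < d b) M a b -
    \sum_(a | 0 < d a) d a <= _); first by rewrite subr_ge0.
  rewrite -sumrB; apply: ler_sum => a /ltW da.
  rewrite -mulrN -{2}[d a]mulr1 -mulrBr ler_wpM2l// lerNr opprB.
  by rewrite lerBrDl; have := M1 a; rewrite (bigID (fun b => 0 < d b)).
move=> a b da db.
have dabs : \sum_(b | ~~ (0 < d b)) M a b = 0.
  have /eqP : d a * \sum_(b | ~~ (0 < d b)) M a b = 0.
    apply: (psumr_eq0P _ E) => // c /ltW dc.
    by rewrite mulr_ge0// sumr_ge0.
  by rewrite mulf_eq0 gt_eqF//= => /eqP.
by apply: (psumr_eq0P _ dabs) => //; rewrite -leNgt.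
Qed.

(** * Recovering word probabilities from the table *)

Section Tables.
Variables (K : realType) (X : finType) (P Q : process K X).
Hypotheses (statP : stationary P) (ergP : ergodic P) (statQ : stationary Q).

(** Sum out the last letter; the induction is on the number of letters missing to reach length
    [n]. *)
Lemma word_pr_le n w :
  (forall u : n.-tuple X, word_pr P u = word_pr Q u) ->
  (size w <= n)%N -> word_pr P w = word_pr Q w.
Proof.
move=> PQ; elim: {w}(n - size w)%N {-2}w (erefl (n - size w)%N) => [|m IHm] w.
  move=> nw wn; have wE : size w == n by rewrite eqn_leq wn -subn_eq0 nw eqxx.
  exact: (PQ (Tuple wE)).
move=> nw wn; rewrite !word_pr_rcons; apply: eq_bigr => a _.
by apply: IHm; rewrite size_rcons; lia.
Qed.

(** The chain rule for [Q], with the conditional probability read off from [P]. If [u] is null for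
    [Q], both sides vanish. *)
Lemma same_cond_table_step L R u v : same_cond_table L R P Q ->
  (1 <= size u <= L)%N -> (size v <= R)%N ->
  word_pr Q (u ++ v) = word_pr Q u * (word_pr P (u ++ v) / word_pr P u).
Proof.
move=> [ctx tab] uL vR.
have ctxE : contexts L P u = contexts L Q u by rewrite ctx.
have [Q0|Q0] := eqVneq (word_pr Q u) 0.
  by rewrite Q0 mul0r word_pr_cat0.
have Qu : contexts L Q u by apply/contextsE.
rewrite -cond_prE// tab ?ctxE// cond_prE//.
by rewrite mulrC divfK.
Qed.

Lemma same_cond_table_context_eq0 L R u : same_cond_table L R P Q ->
  (1 <= size u <= L)%N -> word_pr P u = 0 -> word_pr Q u = 0.
Proof.
move=> [ctx _] uL P0; apply/eqP/negPn/negP => Q0.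
have : contexts L P u by rewrite ctx; apply/contextsE.
by move/contextsE => /(_ statP)[_]; rewrite P0 eqxx.
Qed.

(* [P_1 - Q_1] is invariant under the common one-letter transition matrix, so
   the letters where it is positive form a closed class. *)
Lemma same_cond_table_letter L R a : (1 <= L)%N -> (1 <= R)%N ->
  same_cond_table L R P Q -> word_pr P [:: a] = word_pr Q [:: a].
Proof.
move=> L1 R1 tab.
pose d b := word_pr P [:: b] - word_pr Q [:: b].
(* Division by 0 gives 0, so the row of a null letter vanishes; hence row sums are only bounded by
   1. *)
pose M b c := word_pr P [:: b; c] / word_pr P [:: b].
have PM b c : word_pr P [:: b; c] = word_pr P [:: b] * M b c.
  have [P0|P0] := eqVneq (word_pr P [:: b]) 0.
    by rewrite P0 mul0r (@word_pr_cat0 _ _ _ [:: b]).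
  by rewrite mulrC divfK.
have QM b c : word_pr Q [:: b; c] = word_pr Q [:: b] * M b c.
  exact: (@same_cond_table_step L R [:: b] [:: c]).
have dM c : d c = \sum_b d b * M b c.
  rewrite /d !word_pr_cons// -sumrB; apply: eq_bigr => b _.
  by rewrite PM QM mulrBl.
have M0 b c : 0 <= M b c by rewrite divr_ge0 ?word_pr_ge0.
have M1 b : \sum_c M b c <= 1.
  rewrite -mulr_suml -(word_pr_rcons P [:: b]).
  have [->|P0] := eqVneq (word_pr P [:: b]) 0; first by rewrite mul0r.
  by rewrite divff.
have d_sum : \sum_b d b = 0.
  by rewrite sumrB -!(word_pr_rcons _ [::])// !word_pr_nil subrr.
suff : d a = 0 by move/eqP; rewrite subr_eq0 => /eqP.
have [b c|P0|P0] := @closed_trivial _ _ _ statP ergP (fun b => 0 < d b).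
- rewrite !unfold_in -leNgt => db dc; rewrite PM.
  by rewrite (sub_stationary_positive_closed M0 M1 dM db dc) mulr0.
(* In this case a letter with [d b > 0] would be null for [P], making [d b] minus a probability. *)
- have d_le b : d b <= 0.
    rewrite leNgt; apply/negP => db; have := db.
    by rewrite /d P0// sub0r oppr_gt0 ltNge word_pr_ge0.
  have := @psumr_eq0P _ _ xpredT (fun b => - d b).
  rewrite sumrN d_sum oppr0 => /(_ _ erefl a isT) E.
  by apply/eqP; rewrite -oppr_eq0 E// => b _; rewrite oppr_ge0.
(* Here letters with [d b <= 0] are null for [P], hence for [Q] by equality of contexts, so [d] is
   nonnegative with sum 0. *)
- apply: (psumr_eq0P _ d_sum) => // b _.
  have [/ltW//|db] := boolP (0 < d b).
  by rewrite /d P0// (same_cond_table_context_eq0 tab) ?subrr// P0.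
Qed.

(** The single letter is the base case; each further letter is a future of length 1, which [1 <= R]
    makes available. *)
Lemma same_cond_table_word L R u : (1 <= R)%N -> same_cond_table L R P Q ->
  (1 <= size u <= L)%N -> word_pr P u = word_pr Q u.
Proof.
move=> R1 tab; elim/last_ind: u => [//|u b IHu]; rewrite size_rcons => /= uL.
have [u0|u0] := posnP (size u).
  by rewrite (size0nil u0); apply: same_cond_table_letter tab; lia.
have uL' : (1 <= size u <= L)%N by lia.
rewrite -cats1 (same_cond_table_step tab)// -IHu//.
have [P0|P0] := eqVneq (word_pr P u) 0; first by rewrite P0 mul0r word_pr_cat0.
by rewrite mulrC divfK.
Qed.

End Tables.

End Proof.

Theorem proposition4p2 (K : realType) (X : finType) (hX : (0 < #|X|)%N)
    (P Q : process K X)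
    (statP : stationary P) (ergP : ergodic P)
    (statQ : stationary Q) (ergQ : ergodic Q)
    (L R : nat) (hL : (1 <= L)%N) (hR : (1 <= R)%N) :
  same_cond_table L R P Q <->
  block_law P (L + R) = block_law Q (L + R).
Proof.
split=> [tab|PQ].
  apply: funext => w; rewrite !block_lawE -(cat_take_drop L w).
  (* The first [L] letters serve as context and the last [R] as future. *)
  have sL : size (take L w) = L by rewrite size_takel// size_tuple leq_addr.
  have sR : size (drop L w) = R by rewrite size_drop size_tuple addKn.
  have wL : (1 <= size (take L w) <= L)%N by rewrite sL hL leqnn.
  rewrite (same_cond_table_step _ _ tab wL) ?sR//.
  rewrite -(same_cond_table_word _ _ _ _ tab)//.
  have [P0|P0] := eqVneq (word_pr P (take L w)) 0%R.
    by rewrite P0 GRing.mul0r word_pr_cat0.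
  by rewrite GRing.mulrC GRing.divfK.
(* Every [u] and [u ++ v] occurring in the table has length at most [L + R]. *)
have PQ' w : (size w <= L + R)%N -> word_pr P w = word_pr Q w.
  by apply: word_pr_le => // u; rewrite -!block_lawE PQ.
split=> [|u v /contextsE[]// uL _ vR].
  apply/seteqP; split=> u /contextsE[]// uL u0; apply/contextsE => //.
    by rewrite -PQ'//; lia.
  by rewrite PQ'//; lia.
by rewrite !cond_prE// !PQ' ?size_cat//; lia.
Qed.
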